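(* Suppose $S=\{w\in\mathbb{R}^d : Aw\ge b\}$ is a (nonempty) polytope, where $A\in\mathbb{R}^{m\times d}$ and $b\in\mathbb{R}^m$. Let $(x_1,c_1),\ldots,(x_n,c_n)\in\mathbb{R}^p\times\mathbb{R}^d$ be training data, $\Omega:\mathbb{R}^{d\times p}\to\mathbb{R}$ a regularizer and $\lambda\ge 0$ a regularization parameter. Then the regularized SPO+ empirical risk minimization problem $$\min_{B\in\mathbb{R}^{d\times p}}\ \frac1n\sum_{i=1}^n \ell_{\mathrm{SPO+}}(Bx_i,c_i)+\lambda\Omega(B)$$ is equivalent to the following optimization problem: $$\begin{array}{cll}\min\limits_{B,\,p_1,\ldots,p_n} & \displaystyle\frac1n\sum_{i=1}^n\left[-b^Tp_i+2(w^*(c_i)x_i^T)\bullet B-z^*(c_i)\right]+\lambda\Omega(B) & \\ \text{s.t.} & A^Tp_i=2Bx_i-c_i & \text{for all } i\in\{1,\ldots,n\}\\ & p_i\in\mathbb{R}^m,\ p_i\ge 0 & \text{for all } i\in\{1,\ldots,n\}\\ & B\in\mathbb{R}^{d\times p}. & \end{array}$$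
   Context: For $c\in\mathbb{R}^d$: $z^*(c) := \min_{w\in S} c^Tw$, and $w^*(\cdot):\mathbb{R}^d\to S$ is a fixed mapping with $w^*(c)\in\arg\min_{w\in S} c^Tw$ for all $c$. The SPO+ loss is $\ell_{\mathrm{SPO+}}(\hat c,c) := \max_{w\in S}\{c^Tw-2\hat c^Tw\}+2\hat c^Tw^*(c)-z^*(c)$. For $B_1,B_2\in\mathbb{R}^{d\times p}$, $B_1\bullet B_2 := \mathrm{trace}(B_1^TB_2)$. For $w\in\mathbb{R}^d$, $x\in\mathbb{R}^p$, $wx^T$ is the $d\times p$ outer product matrix with entries $(wx^T)_{ij}=w_ix_j$. A polytope is bounded; vector inequalities are componentwise. (The integer $p$, the feature dimension, is unrelated to the decision vectors $p_i$.) *)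

(* Defs.v *)
From HB Require Import structures.
From mathcomp Require Import all_boot all_order all_algebra.
From mathcomp Require Import boolp classical_sets reals ereal topology normedtype.

Set Implicit Arguments.
Unset Strict Implicit.
Unset Printing Implicit Defensive.

Import Order.TTheory GRing.Theory Num.Theory.
Import numFieldNormedType.Exports.

Local Open Scope classical_set_scope.
Local Open Scope ring_scope.

Definition dot (R : realType) (k : nat) (u v : 'cV[R]_k) : R :=
  (u^T *m v) 0 0.

Definition frob (R : realType) (d p : nat) (B1 B2 : 'M[R]_(d, p)) : R :=
  \tr (B1^T *m B2).

Definition outer (R : realType) (d p : nat) (w : 'cV[R]_d) (x : 'cV[R]_p) :
    'M[R]_(d, p) :=
  \matrix_(i, j) (w i 0 * x j 0).

Definition polyhedron (R : realType) (m d : nat) (A : 'M[R]_(m, d))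
    (b : 'cV[R]_m) : set 'cV[R]_d :=
  [set w | forall i, b i 0 <= (A *m w) i 0].

(** The problem "minimize [f t] subject to [F t]". Its optimal value is an
    extended real: [+oo] if infeasible, [-oo] if unbounded below. *)
Definition argmin (R : realType) (T : Type) (F : set T) (f : T -> R) : set T :=
  [set t | F t /\ forall u, F u -> f t <= f u].

Definition opt_value (R : realType) (T : Type) (F : set T) (f : T -> R) :
    \bar R :=
  ereal_inf [set (f t)%:E | t in F].

(** [inf] and [sup] below are attained, hence are a minimum and a maximum, as
    soon as every linear form has a minimizer on [S]: see [zstar_min] and
    [spo_plus_max]. *)
Definition zstar (R : realType) (d : nat) (S : set 'cV[R]_d) (c : 'cV[R]_d) :
    R :=
  inf [set dot c w | w in S].

Definition spo_plus (R : realType) (d : nat) (S : set 'cV[R]_d)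
    (wstar : 'cV[R]_d -> 'cV[R]_d) (chat c : 'cV[R]_d) : R :=
  sup [set dot c w - 2 * dot chat w | w in S]
    + 2 * dot chat (wstar c) - zstar S c.

Lemma zstar_min (R : realType) (d : nat) (S : set 'cV[R]_d)
    (c w : 'cV[R]_d) :
  argmin S (dot c) w -> zstar S c = dot c w.
Proof.
move=> [Sw wmin]; apply/eqP; rewrite eq_le; apply/andP; split.
  by apply: ge_inf; [exists (dot c w) => _ [u Su <-]; exact: wmin|exists w].
by apply: lb_le_inf => [|_ [u Su <-]]; [exists (dot c w), w|exact: wmin].
Qed.

Lemma spo_plus_max (R : realType) (d : nat) (S : set 'cV[R]_d)
    (chat c w : 'cV[R]_d) :
  argmin S (dot (2 *: chat - c)) w ->
  (forall u, S u -> dot c u - 2 * dot chat u <= dot c w - 2 * dot chat w) /\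
  sup [set dot c u - 2 * dot chat u | u in S] = dot c w - 2 * dot chat w.
Proof.
have E u : dot (2 *: chat - c) u = - (dot c u - 2 * dot chat u).
  by rewrite /dot linearB linearZ mulmxBl -scalemxAl !mxE opprB.
move=> [Sw wmin].
have wmax u : S u -> dot c u - 2 * dot chat u <= dot c w - 2 * dot chat w.
  by move=> /wmin; rewrite !E lerN2.
split=> //; apply/eqP; rewrite eq_le; apply/andP; split.
  by apply: ge_sup => [|_ [u Su <-]]; [exists (dot c w - 2 * dot chat w), w|exact: wmax].
by apply: ub_le_sup; [eexists => _ [u Su <-]; exact: wmax|exists w].
Qed.

Definition erm_obj (R : realType) (d p n : nat) (S : set 'cV[R]_d)
    (wstar : 'cV[R]_d -> 'cV[R]_d) (x : 'I_n -> 'cV[R]_p)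
    (c : 'I_n -> 'cV[R]_d) (Omega : 'M[R]_(d, p) -> R) (lambda : R)
    (B : 'M[R]_(d, p)) : R :=
  n%:R^-1 * (\sum_(i < n) spo_plus S wstar (B *m x i) (c i))
    + lambda * Omega B.

(** In [v : 'M[R]_(d, p) * ('I_n -> 'cV[R]_m)], [v.1] is the matrix [B] and
    [v.2 i] is the dual vector attached to the [i]-th observation. *)
Definition reform_feasible (R : realType) (m d p n : nat) (A : 'M[R]_(m, d))
    (x : 'I_n -> 'cV[R]_p) (c : 'I_n -> 'cV[R]_d) :
    set ('M[R]_(d, p) * ('I_n -> 'cV[R]_m)) :=
  [set v | forall i, A^T *m v.2 i = 2 *: (v.1 *m x i) - c i /\
                     forall k, 0 <= v.2 i k 0].

Definition reform_obj (R : realType) (m d p n : nat) (S : set 'cV[R]_d)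
    (b : 'cV[R]_m) (wstar : 'cV[R]_d -> 'cV[R]_d) (x : 'I_n -> 'cV[R]_p)
    (c : 'I_n -> 'cV[R]_d) (Omega : 'M[R]_(d, p) -> R) (lambda : R)
    (v : 'M[R]_(d, p) * ('I_n -> 'cV[R]_m)) : R :=
  n%:R^-1 * (\sum_(i < n) (- dot b (v.2 i)
                           + 2 * frob (outer (wstar (c i)) (x i)) v.1
                           - zstar S (c i)))
    + lambda * Omega v.1.

(** The problem over pairs [(B, y)] is an exact reformulation of the problem
    over [B]: equal optimal values, the optimal [B]'s are the first components
    of the optimal pairs, and for each fixed [B] the minimum over [y] is
    attained and equals the objective at [B]. *)
Definition equivalent_problems (R : realType) (T U : Type)
    (F : set T) (f : T -> R) (G : set (T * U)) (g : T * U -> R) : Prop :=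
  [/\ opt_value F f = opt_value G g,
      forall B, argmin F f B <-> exists y, argmin G g (B, y),
      forall B y, G (B, y) -> F B &
      forall B, F B ->
        exists2 y, argmin [set y | G (B, y)] (fun y => g (B, y)) y &
                   g (B, y) = f B].

(* Main.v *)
Require Import Defs.
From HB Require Import structures.
From mathcomp Require Import all_boot all_order all_algebra.
From mathcomp Require Import boolp classical_sets reals ereal topology normedtype.
Import Order.TTheory GRing.Theory Num.Theory.
Import numFieldNormedType.Exports.
Local Open Scope classical_set_scope.
Local Open Scope ring_scope.

(** For a fixed [B] and each observation [i], put [q = 2 B x_i - c_i]. The
    maximum in the SPO+ loss is [- min_(w in S) q^T w], and LP duality turns
    this minimum into the maximum of [b^T y] over [y >= 0], [A^T y = q].
    Minimizing the reformulation over the dual vectors alone therefore gives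
    the empirical risk at [B]. Strong duality is obtained from the Farkas lemma
    applied to the constraints that are active at an optimal [w]. *)

(* Induction on the number of forms. If [a] is needed, some [h] has
   [A h >= 0], [c h < 0] and, after scaling, [a h = -1]; projecting along [h]
   onto the kernel of [a] eliminates [a]. *)
Lemma farkas (R : realFieldType) (m d : nat) (A : 'M[R]_(m, d))
    (c : 'rV[R]_d) :
  (forall h : 'cV[R]_d, (forall i, 0 <= (A *m h) i 0) -> 0 <= (c *m h) 0 0) ->
  exists2 y : 'rV[R]_m, (forall i, 0 <= y 0 i) & y *m A = c.
Proof.
elim: m A c => [|m IH] A c Hc.
  exists 0 => [i|]; first by rewrite mxE.
  rewrite mul0mx; apply/rowP => j; rewrite mxE; apply/eqP.
  (* With no forms left, every [h] is admissible. Testing multiples of a basis vector, the choice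
     [t = - c 0 j] forces the square of [c 0 j] to vanish. *)
  have Hj t : 0 <= c 0 j * t.
    have : 0 <= (c *m (t *: delta_mx j 0 : 'cV[R]_d)) 0 0 by apply: Hc; case.
    by rewrite -scalemxAr mxE -colE mxE mulrC.
  have := Hj (- c 0 j); rewrite mulrN oppr_ge0 -expr2 => cj_le0.
  by rewrite eq_sym -sqrf_eq0 eq_le cj_le0 sqr_ge0.
rewrite -[m.+1]/(1 + m)%N in A Hc *.
rewrite -[A]vsubmxK in Hc *; move: (usubmx A) (dsubmx A) Hc => a {}A Hc.
have {}Hc (h : 'cV[R]_d) : 0 <= (a *m h) 0 0 -> (forall i, 0 <= (A *m h) i 0) ->
    0 <= (c *m h) 0 0.
  move=> ah Ah; apply: Hc => i; rewrite mul_col_mx mxE.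
  by case: splitP => j _ //; rewrite (ord1 j).
(* If the rows of [A] alone already imply the inequality, [a] gets multiplier 0. *)
have [Hall|] := pselect (forall h : 'cV[R]_d,
    (forall i, 0 <= (A *m h) i 0) -> 0 <= (c *m h) 0 0).
  have [y y0 yA] := IH A c Hall.
  exists (row_mx 0 y); last by rewrite mul_row_col mul0mx add0r.
  by move=> i; rewrite mxE; case: splitP => j _ //; rewrite mxE.
move=> /existsNP [h0] /not_implyP [Ah0] /negP; rewrite -ltNge => ch0.
have ah0 : (a *m h0) 0 0 < 0.
  by rewrite ltNge; apply/negP => ah0; have := Hc _ ah0 Ah0; rewrite leNgt ch0.
have [h [Ah ch ah]] : exists h : 'cV[R]_d, [/\ forall i, 0 <= (A *m h) i 0,
    (c *m h) 0 0 < 0 & a *m h = (- 1)%:M].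
  have k0 : 0 < - ((a *m h0) 0 0)^-1 by rewrite oppr_gt0 invr_lt0.
  exists ((- ((a *m h0) 0 0)^-1) *: h0); split => [i||].
  - by rewrite -scalemxAr mxE mulr_ge0 // ltW.
  - by rewrite -scalemxAr mxE pmulr_rlt0.
  - apply/rowP => i; rewrite (ord1 i) -scalemxAr mxE [RHS]mxE eqxx.
    by rewrite mulNr mulVf // lt_eqF.
(* The projection sends [z] to [z + h (a z)], which [a] kills because [a h = -1]. *)
have Hproj (z : 'cV[R]_d) : (forall i, 0 <= ((A + A *m h *m a) *m z) i 0) ->
    0 <= ((c + c *m h *m a) *m z) 0 0.
  have E k (M : 'M[R]_(k, d)) :
      (M + M *m h *m a) *m z = M *m (z + h *m (a *m z)).
    by rewrite mulmxDl mulmxDr !mulmxA.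
  move=> Hz; rewrite E; apply: Hc => [|i]; last by rewrite -E.
  by rewrite mulmxDr mulmxA ah mul_scalar_mx scaleN1r subrr mxE.
have [y y0 yA] := IH _ _ Hproj.
(* The multiplier of [a] is read off from [y (A + A h a) = c + c h a]; it is nonnegative since [y]
   and [A h] are, while [c h < 0]. *)
exists (row_mx (y *m A *m h - c *m h) y) => [i|].
  rewrite mxE; case: splitP => j _ //; rewrite (ord1 j) mxE [X in _ + X]mxE.
  rewrite subr_ge0 (le_trans (ltW ch)) // -mulmxA mxE.
  by apply: sumr_ge0 => k _; rewrite mulr_ge0.
apply/(addIr (c *m h *m a)); rewrite -yA mul_row_col mulmxDr mulmxBl !mulmxA.
by rewrite addrAC subrK addrC.
Qed.

(** Used with [s] the slacks at a feasible point and [t] their rates of change along a direction: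
    the point can move a little and stay feasible. *)
Lemma small_step (R : realFieldType) (m : nat) (s t : 'I_m -> R) :
  (forall i, 0 <= s i) -> (forall i, s i = 0 -> 0 <= t i) ->
  exists2 e, 0 < e & forall i, 0 <= s i + e * t i.
Proof.
(* [N] bounds every ratio with [s i > 0]; a zero slack contributes 0, as the inverse of 0 is 0. *)
move=> s0 t0; pose N := \sum_i `|t i| / s i.
have term_ge0 i : 0 <= `|t i| / s i by rewrite divr_ge0.
have N0 : 0 < 1 + N by rewrite ltr_pwDl // sumr_ge0.
exists (1 + N)^-1 => [|i]; first by rewrite invr_gt0.
rewrite -(pmulr_rge0 _ N0) mulrDr mulVKf ?gt_eqF //.
have [si|si] := eqVneq (s i) 0; first by rewrite si mulr0 add0r t0.
have si0 : 0 < s i by rewrite lt_def si s0.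
have tN : `|t i| <= N * s i.
  by rewrite -ler_pdivrMr // /N (bigD1 i) //= lerDl sumr_ge0.
rewrite mulrDl mul1r -addrA addr_ge0 // -[t i]opprK subr_ge0.
by rewrite (le_trans _ tN) // (le_trans (ler_norm _)) // normrN.
Qed.

Lemma dotC (R : realType) (k : nat) (u v : 'cV[R]_k) : dot u v = dot v u.
Proof. by rewrite /dot -[u^T *m v]trmxK trmx_mul trmxK mxE. Qed.

Lemma dot_trmx_mul (R : realType) (m d : nat) (A : 'M[R]_(m, d))
    (y : 'cV[R]_m) (w : 'cV[R]_d) :
  dot (A^T *m y) w = dot (A *m w) y.
Proof. by rewrite dotC /dot trmx_mul mulmxA. Qed.

Lemma lp_weak_duality (R : realType) (m d : nat) (A : 'M[R]_(m, d))
    (b : 'cV[R]_m) (w : 'cV[R]_d) (y : 'cV[R]_m) :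
  polyhedron A b w -> (forall i, 0 <= y i 0) ->
  dot b y <= dot (A^T *m y) w.
Proof.
move=> Sw y0; rewrite dot_trmx_mul /dot !mxE; apply: ler_sum => i _.
by rewrite !mxE ler_wpM2r // (le_trans (Sw i)) // mxE.
Qed.

Lemma lp_strong_duality (R : realType) (m d : nat) (A : 'M[R]_(m, d))
    (b : 'cV[R]_m) (q w : 'cV[R]_d) :
  argmin (polyhedron A b) (dot q) w ->
  exists y : 'cV[R]_m,
    [/\ A^T *m y = q, forall i, 0 <= y i 0 & dot b y = dot q w].
Proof.
move=> [Sw wmin].
(* A 0/1 mask: [diag_mx active *m A] zeroes the inactive rows, so they impose nothing in [farkas]
   and the index type stays ['I_m]. *)
pose active : 'rV[R]_m := \row_i (b i 0 == (A *m w) i 0)%:R.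
have [h Hh|z z0 zq] := @farkas R m d (diag_mx active *m A) q^T.
  (* A short step from [w] along [h] stays feasible, so optimality of [w] gives [q^T h >= 0]. *)
  have [i|i|e e0 He] := @small_step R m (fun i => (A *m w) i 0 - b i 0)
    (fun i => (A *m h) i 0).
  - by rewrite subr_ge0; exact: Sw.
  - move=> /eqP; rewrite subr_eq0 eq_sym => act.
    have := Hh i; rewrite -mulmxA mul_diag_mx mxE [active _ _]mxE act.
    by rewrite mul1r.
  have /wmin : polyhedron A b (w + e *: h).
    move=> i; rewrite mulmxDr -scalemxAr mxE [X in _ + X]mxE.
    by rewrite -subr_ge0 addrAC; exact: He.
  by rewrite /dot mulmxDr -scalemxAr !mxE lerDl pmulr_rge0.
(* Masking the multipliers builds in complementary slackness, hence [b^T y = (A w)^T y = q^T w]. *)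
exists (z *m diag_mx active)^T; split => [|i|].
- by rewrite -trmx_mul -mulmxA zq trmxK.
- by rewrite mxE mul_mx_diag !mxE mulr_ge0.
rewrite -[q]trmxK -zq mulmxA [(_ *m A)^T]trmx_mul dot_trmx_mul /dot !mxE.
apply: eq_bigr => i _; rewrite [b^T _ _]mxE [(A *m w)^T _ _]mxE.
have -> : (z *m diag_mx active)^T i 0 = z 0 i * (b i 0 == (A *m w) i 0)%:R.
  by rewrite mxE mul_mx_diag !mxE.
by case: eqP => [->|_]; rewrite ?mulr0.
Qed.

Lemma frob_outer (R : realType) (d p : nat) (w : 'cV[R]_d) (x : 'cV[R]_p)
    (B : 'M[R]_(d, p)) : frob (outer w x) B = dot (B *m x) w.
Proof.
have -> : outer w x = w *m x^T.
  by apply/matrixP => i j; rewrite !mxE big_ord1 mxE.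
by rewrite dotC /frob /dot trmx_mul trmxK -mulmxA mxtrace_mulC -mulmxA trace_mx11.
Qed.

(** Reduces the equivalence to two facts on each fibre over [B]: weak duality will supply the lower
    bound and strong duality its attainment. *)
Lemma equivalent_problems_partial_min (R : realType) (T U : Type)
    (F : set T) (f : T -> R) (G : set (T * U)) (g : T * U -> R) :
  (forall B y, G (B, y) -> F B /\ f B <= g (B, y)) ->
  (forall B, F B -> exists2 y, G (B, y) & g (B, y) = f B) ->
  equivalent_problems F f G g.
Proof.
move=> le_fg attained; split.
- apply/eqP; rewrite eq_le; apply/andP; split.
    apply/ereal_infP => _ [[B y] /= GBy <-].
    have [FB fg] := le_fg _ _ GBy.
    by apply: (@le_trans _ _ (f B)%:E); [apply: ereal_inf_lbound; exists B|].
  apply/ereal_infP => _ [B FB <-]; have [y GBy <-] := attained B FB.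
  by apply: ereal_inf_lbound; exists (B, y).
- move=> B; split.
    move=> [FB fmin]; have [y GBy gf] := attained B FB; exists y; split => //.
    move=> [B' y'] /le_fg [FB' fg']; rewrite gf.
    exact: le_trans (fmin _ FB') fg'.
  move=> [y [GBy gmin]]; have [FB fg] := le_fg _ _ GBy; split => // B' FB'.
  have [y' GBy' <-] := attained B' FB'.
  exact: le_trans fg (gmin _ GBy').
- by move=> B y /le_fg[].
- move=> B FB; have [y GBy gf] := attained B FB; exists y => //; split => // u.
  by rewrite gf => /le_fg[].
Qed.

Lemma spo_plusE (R : realType) (d : nat) (S : set 'cV[R]_d)
    (wstar : 'cV[R]_d -> 'cV[R]_d) (chat c w : 'cV[R]_d) :
  argmin S (dot (2 *: chat - c)) w ->
  spo_plus S wstar chat c =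
    - dot (2 *: chat - c) w + 2 * dot chat (wstar c) - zstar S c.
Proof.
move=> /spo_plus_max[_ smax]; rewrite /spo_plus smax.
have -> : dot (2 *: chat - c) w = 2 * dot chat w - dot c w.
  by rewrite /dot linearB linearZ mulmxBl -scalemxAl !mxE.
by rewrite opprB.
Qed.

Theorem proposition7 (R : realType) (m d p n : nat)
    (A : 'M[R]_(m, d)) (b : 'cV[R]_m)
    (S_nonempty : polyhedron A b !=set0)
    (S_bounded : bounded_set (polyhedron A b))
    (wstar : 'cV[R]_d -> 'cV[R]_d)
    (wstar_argmin : forall c0 : 'cV[R]_d,
       argmin (polyhedron A b) (dot c0) (wstar c0))
    (n_gt0 : (0 < n)%N)
    (x : 'I_n -> 'cV[R]_p) (c : 'I_n -> 'cV[R]_d)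
    (Omega : 'M[R]_(d, p) -> R) (lambda : R) (lambda_ge0 : 0 <= lambda) :
  equivalent_problems
    [set: 'M[R]_(d, p)]
    (erm_obj (polyhedron A b) wstar x c Omega lambda)
    (reform_feasible A x c)
    (reform_obj (polyhedron A b) b wstar x c Omega lambda).
Proof.
pose q B i := 2 *: (B *m x i) - c i.
(* In this form the two objectives differ only in [dot (q B i) (wstar (q B i))] against
   [dot b (y i)]. *)
have ermE B : erm_obj (polyhedron A b) wstar x c Omega lambda B =
    n%:R^-1 * (\sum_(i < n) (- dot (q B i) (wstar (q B i))
      + 2 * frob (outer (wstar (c i)) (x i)) B
      - zstar (polyhedron A b) (c i))) + lambda * Omega B.
  congr (_ * _ + _); apply: eq_bigr => i _.
  by rewrite frob_outer (spo_plusE _ _ _ _ _ _ _ (wstar_argmin _)).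
apply: equivalent_problems_partial_min => [B y GBy|B _].
  split=> //; rewrite ermE lerD2r ler_wpM2l ?invr_ge0 ?ler0n //.
  apply: ler_sum => i _; rewrite !lerD2r lerN2; have [yq y0] := GBy i.
  rewrite /q -yq; apply: lp_weak_duality => //.
  by case: (wstar_argmin (A^T *m y i)).
(* The constraints decouple over observations, so optimal dual vectors can be chosen separately for
   each [i]. *)
have [y Hy] := choice (fun i =>
  lp_strong_duality _ _ _ _ _ _ _ (wstar_argmin (q B i))).
exists y => [i|]; first by have [] := Hy i.
rewrite ermE; congr (_ * _ + _); apply: eq_bigr => i _.
by have [_ _ <-] := Hy i.
Qed.
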